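(* Let $M$ be a finitely generated commutative monoid of rank $r$, and let $M$ act on a set $X$ by a bounded-to-one action. Then $$\operatorname{asdim}(M\curvearrowright X)\le N_r,\qquad N_r:=\sum_{j=1}^{r}3^j=\frac{3^{r+1}-3}{2}.$$
   Context: Monoids are commutative with identity, written additively; the action is written $mx$, so $0x=x$ and $(m+n)x=m(nx)$. No freeness of the action is assumed. An action $M\curvearrowright X$ is bounded-to-one if for each $m\in M$ there is a finite $k_m$ such that every fiber of the map $x\mapsto mx$ on $X$ has at most $k_m$ elements ($k_m$ may depend on $m$). The rank of $M$ is $\operatorname{rk}(M)=\dim_{\mathbb Q}(M^{\mathrm{gp}}\otimes_{\mathbb Z}\mathbb Q)$, where $M^{\mathrm{gp}}$ is the group completion (Grothendieck group) of $M$. For a finite generating set $S$ of $M$, the (undirected) Schreier graph on $X$ has an edge between $x$ and $sx$ for every $x\in X$, $s\in S$, with loops discarded. Its path metric is an extended metric $d_X:X\times X\to\mathbb N\cup\{\infty\}$ (distinct components are at distance $\infty$). An extended metric space $X$ has $\operatorname{asdim}X\le n$ if for every integer $s\ge1$ there is a partition of $X$ into uniformly bounded sets (i.e. there is one finite bound on the diameters of all the parts) such that each closed ball $B_X(x,s)=\{y:d_X(x,y)\le s\}$ meets at most $n+1$ parts. $\operatorname{asdim}(M\curvearrowright X)$ denotes the asymptotic dimension of $X$ with the Schreier metric; it does not depend on the choice of the finite generating set. *)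

(* Defs.v *)
From HB Require Import structures.
From mathcomp Require Import all_boot all_order all_algebra generic_quotient.
From mathcomp Require Import mathcomp_extra boolp classical_sets functions.
From mathcomp Require Import cardinality.

Set Implicit Arguments.
Unset Strict Implicit.
Unset Printing Implicit Defensive.

Import GRing.Theory.

Local Open Scope quotient_scope.
Local Open Scope classical_set_scope.
Local Open Scope card_scope.
Local Open Scope ring_scope.

(* Grothendieck group of a commutative monoid M: the class of (a, b) is the
   formal difference a - b.  The extra summand c is needed because M is not
   assumed cancellative. *)
Section Groupification.
Variable M : nmodType.
Implicit Types p q : M * M.

Definition gp_rel p q : bool :=
  `[< exists c : M, p.1 + q.2 + c = q.1 + p.2 + c >].

Lemma gp_rel_refl : reflexive gp_rel.
Proof. by move=> p; apply/asboolP; exists 0. Qed.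

Lemma gp_rel_sym : symmetric gp_rel.
Proof. by move=> p q; apply/asboolP/asboolP => -[c e]; exists c. Qed.

Lemma gp_rel_trans : transitive gp_rel.
Proof.
move=> [c d] [a b] [e f] /asboolP[/= u h1] /asboolP[/= v h2].
apply/asboolP; exists (c + d + u + v); rewrite /= !addrA.
rewrite [LHS](ACl ((1*4*5)*(3*2*6))) /= h1 h2 !addrA.
by rewrite [LHS](ACl (4*2*1*5*3*6)).
Qed.

Canonical gp_rel_equiv := EquivRel gp_rel gp_rel_refl gp_rel_sym gp_rel_trans.

Definition groupification := {eq_quot gp_rel}.
HB.instance Definition _ := Choice.on groupification.
HB.instance Definition _ := EqQuotient.on groupification.

Lemma gp_piP p q :
  \pi_groupification p = \pi_groupification q <->
  exists c : M, p.1 + q.2 + c = q.1 + p.2 + c.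
Proof. by split=> [/eqmodP/asboolP|h] //; exact/eqmodP/asboolP. Qed.

Definition gp_zero : groupification := \pi_groupification (0, 0).
Definition gp_add (x y : groupification) : groupification :=
  \pi_groupification ((repr x).1 + (repr y).1, (repr x).2 + (repr y).2).
Definition gp_opp (x : groupification) : groupification :=
  \pi_groupification ((repr x).2, (repr x).1).

Lemma gp_add_pi p q :
  gp_add (\pi_groupification p) (\pi_groupification q) = \pi_groupification (p.1 + q.1, p.2 + q.2).
Proof.
have /gp_piP[u hu] := reprK (\pi_groupification p).
have /gp_piP[v hv] := reprK (\pi_groupification q).
apply/gp_piP; exists (u + v); rewrite /= !addrA.
rewrite [LHS](ACl ((1*3*5)*(2*4*6))) /= hu hv !addrA.
by rewrite [LHS](ACl (1*4*2*5*3*6)).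
Qed.

Lemma gp_addA : associative gp_add.
Proof.
move=> x y z.
rewrite -[x]reprK -[y]reprK -[z]reprK.
move: (repr x) (repr y) (repr z) => p q s.
by rewrite (gp_add_pi q s) (gp_add_pi p q) !gp_add_pi /= !addrA.
Qed.

Lemma gp_addC : commutative gp_add.
Proof.
move=> x y; rewrite -[x]reprK -[y]reprK.
by rewrite !gp_add_pi addrC [X in (_, X)]addrC.
Qed.

Lemma gp_add0 : left_id gp_zero gp_add.
Proof. by move=> x; rewrite -[x]reprK gp_add_pi !add0r; case: (repr x). Qed.

Lemma gp_addN : left_inverse gp_zero gp_opp gp_add.
Proof.
move=> x; rewrite /gp_opp -[X in gp_add _ X]reprK gp_add_pi.
by apply/gp_piP; exists 0; rewrite /= !addr0 add0r addrC.
Qed.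

HB.instance Definition _ :=
  GRing.isZmodule.Build groupification gp_addA gp_addC gp_add0 gp_addN.

End Groupification.

(* A (x)_Z K for an abelian group A and a ring K, as a left K-module: a finite
   sequence [:: (a1, k1); ...; (an, kn)] stands for the sum of the pure tensors
   ai (x) ki, and tens_eq is the additive congruence generated by
   commutativity and biadditivity.  The quotient is a group since
   a (x) k + (- a) (x) k = 0 (x) k = 0. *)
Section ScalarExtension.
Variables (A : zmodType) (K : pzRingType).
Implicit Types (a : A) (k : K) (s t : seq (A * K)).

Inductive tens_eq : seq (A * K) -> seq (A * K) -> Prop :=
| tens_refl s : tens_eq s s
| tens_sym s t : tens_eq s t -> tens_eq t s
| tens_trans s t u : tens_eq s t -> tens_eq t u -> tens_eq s u
| tens_cat s s' t t' :
    tens_eq s s' -> tens_eq t t' -> tens_eq (s ++ t) (s' ++ t')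
| tens_catC s t : tens_eq (s ++ t) (t ++ s)
| tens_addl a a' k : tens_eq [:: (a + a', k)] [:: (a, k); (a', k)]
| tens_addr a k k' : tens_eq [:: (a, k + k')] [:: (a, k); (a, k')]
| tens_0l k : tens_eq [:: (0, k)] [::].

Definition tens_rel s t : bool := `[< tens_eq s t >].

Lemma tens_rel_refl : reflexive tens_rel.
Proof. by move=> s; apply/asboolP; exact: tens_refl. Qed.

Lemma tens_rel_sym : symmetric tens_rel.
Proof. by move=> s t; apply/asboolP/asboolP; exact: tens_sym. Qed.

Lemma tens_rel_trans : transitive tens_rel.
Proof.
by move=> t s u /asboolP st /asboolP tu; apply/asboolP; exact: tens_trans tu.
Qed.

Canonical tens_rel_equiv :=
  EquivRel tens_rel tens_rel_refl tens_rel_sym tens_rel_trans.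

Definition scalar_ext := {eq_quot tens_rel}.
HB.instance Definition _ := Choice.on scalar_ext.
HB.instance Definition _ := EqQuotient.on scalar_ext.

Lemma tens_piP s t :
  \pi_scalar_ext s = \pi_scalar_ext t <-> tens_eq s t.
Proof. by split=> [/eqmodP/asboolP|h] //; exact/eqmodP/asboolP. Qed.

Definition tens_oppseq s := [seq (- p.1, p.2) | p <- s].
Definition tens_scaleseq k s := [seq (p.1, k * p.2) | p <- s].

Definition tens_zero : scalar_ext := \pi_scalar_ext [::].
Definition tens_add (x y : scalar_ext) : scalar_ext := \pi_scalar_ext (repr x ++ repr y).
Definition tens_opp (x : scalar_ext) : scalar_ext :=
  \pi_scalar_ext (tens_oppseq (repr x)).
Definition tens_scale k (x : scalar_ext) : scalar_ext :=
  \pi_scalar_ext (tens_scaleseq k (repr x)).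

Lemma tens_add_pi s t :
  tens_add (\pi_scalar_ext s) (\pi_scalar_ext t) = \pi_scalar_ext (s ++ t).
Proof. by apply/tens_piP; apply: tens_cat; apply/tens_piP; rewrite reprK. Qed.

Lemma tens_scale_eq k s t :
  tens_eq s t -> tens_eq (tens_scaleseq k s) (tens_scaleseq k t).
Proof.
elim=> {s t} [s|s t _|s t u _ + _|s s' t t' _ + _|s t|a a' l|a l l'|l] /=.
- exact: tens_refl.
- exact: tens_sym.
- exact: tens_trans.
- by rewrite /tens_scaleseq !map_cat; exact: tens_cat.
- by rewrite /tens_scaleseq !map_cat; exact: tens_catC.
- exact: tens_addl.
- by rewrite mulrDr; exact: tens_addr.
- exact: tens_0l.
Qed.

Lemma tens_scale_pi k s :
  tens_scale k (\pi_scalar_ext s) = \pi_scalar_ext (tens_scaleseq k s).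
Proof.
by apply/tens_piP; apply: tens_scale_eq; apply/tens_piP; rewrite reprK.
Qed.

Lemma tens_addA : associative tens_add.
Proof.
move=> x y z; rewrite -[x]reprK -[y]reprK -[z]reprK.
move: (repr x) (repr y) (repr z) => s t u.
rewrite (tens_add_pi t u) (tens_add_pi s t).
by rewrite (tens_add_pi s (t ++ u)) (tens_add_pi (s ++ t) u) catA.
Qed.

Lemma tens_addC : commutative tens_add.
Proof.
move=> x y; rewrite -[x]reprK -[y]reprK.
by rewrite !tens_add_pi; apply/tens_piP; exact: tens_catC.
Qed.

Lemma tens_add0 : left_id tens_zero tens_add.
Proof. by move=> x; rewrite -[x]reprK tens_add_pi. Qed.

Lemma tens_catCA p s t : tens_eq (s ++ p :: t) (p :: s ++ t).
Proof.
rewrite -cat_rcons -cats1.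
exact: tens_cat (tens_catC s [:: p]) (tens_refl t).
Qed.

Lemma tens_oppseq_cat s : tens_eq (tens_oppseq s ++ s) [::].
Proof.
elim: s => [|[a k] s ih] /=; first exact: tens_refl.
apply: (@tens_trans _ ([:: (- a, k); (a, k)] ++ (tens_oppseq s ++ s))).
  apply: (@tens_cat [:: _] [:: _]); first exact: tens_refl.
  exact: tens_catCA.
apply: (@tens_cat _ [::] _ [::]) ih.
apply: tens_trans (tens_sym (tens_addl _ _ _)) _.
by rewrite addNr; exact: tens_0l.
Qed.

Lemma tens_addN : left_inverse tens_zero tens_opp tens_add.
Proof.
move=> x; rewrite /tens_opp -[X in tens_add _ X]reprK tens_add_pi.
by apply/tens_piP; exact: tens_oppseq_cat.
Qed.

HB.instance Definition _ :=
  GRing.isZmodule.Build scalar_ext tens_addA tens_addC tens_add0 tens_addN.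

Lemma tens_scaleA k l (x : scalar_ext) :
  tens_scale k (tens_scale l x) = tens_scale (k * l) x.
Proof.
rewrite -[x]reprK; move: (repr x) => s.
rewrite (tens_scale_pi l s) !tens_scale_pi /tens_scaleseq -map_comp.
by apply: congr1; apply: eq_map => p /=; rewrite mulrA.
Qed.

Lemma tens_scale1 : left_id 1 tens_scale.
Proof.
move=> x; rewrite -[x]reprK tens_scale_pi.
by apply: congr1; rewrite -[RHS]map_id; apply: eq_map => -[a k]; rewrite /= mul1r.
Qed.

Lemma tens_scaleDr : right_distributive tens_scale +%R.
Proof.
move=> k x y; rewrite -[x]reprK -[y]reprK.
move: (repr x) (repr y) => s t.
by rewrite [_ + _](tens_add_pi s t) !tens_scale_pi [RHS]tens_add_pi
  /tens_scaleseq map_cat.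
Qed.

Lemma tens_scaleDl (x : scalar_ext) :
  {morph (fun k => tens_scale k x) : k l / k + l}.
Proof.
move=> k l; rewrite -[x]reprK; move: (repr x) => s.
rewrite !tens_scale_pi [RHS]tens_add_pi.
apply/tens_piP; elim: s => [|[a m] s ih] /=; first exact: tens_refl.
apply: (@tens_trans _ ([:: (a, k * m); (a, l * m)] ++
    (tens_scaleseq k s ++ tens_scaleseq l s))).
  by apply: (@tens_cat [:: _]) ih; rewrite mulrDl; exact: tens_addr.
apply: (@tens_cat [:: _] [:: _]); first exact: tens_refl.
exact: tens_sym (tens_catCA _ _ _).
Qed.

HB.instance Definition _ := GRing.Zmodule_isLmodule.Build K scalar_ext
  tens_scaleA tens_scale1 tens_scaleDr tens_scaleDl.

End ScalarExtension.

(* V has a basis with n elements. *)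
Definition has_dim (K : fieldType) (V : lmodType K) (n : nat) : Prop :=
  exists e : 'I_n -> V,
    forall v : V, exists! c : {ffun 'I_n -> K}, v = \sum_i c i *: e i.

Definition has_rank (M : nmodType) (r : nat) : Prop :=
  has_dim (scalar_ext (groupification M) rat) r.

Definition submonoid (M : nmodType) (A : set M) : Prop :=
  A 0 /\ forall m n, A m -> A n -> A (m + n).

Definition generates (M : nmodType) (S : set M) : Prop :=
  smallest (@submonoid M) S = setT.

Definition finitely_generated (M : nmodType) : Prop :=
  exists S : set M, finite_set S /\ generates S.

Definition monoid_action (M : nmodType) (X : Type) (act : M -> X -> X) : Prop :=
  (forall x, act 0 x = x) /\
  (forall m n x, act (m + n) x = act m (act n x)).

Definition bounded_to_one (M X : Type) (act : M -> X -> X) : Prop :=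
  forall m, exists k : nat, forall y, act m @^-1` [set y] #<= `I_k.

(* Extended distances with values in N u {oo}; None encodes oo. *)
Definition edist (X : Type) := X -> X -> option nat.

Definition dist_le (X : Type) (d : edist X) (x y : X) (n : nat) : Prop :=
  if d x y is Some k then (k <= n)%N else False.

Definition cball (X : Type) (d : edist X) (x : X) (s : nat) : set X :=
  [set y | dist_le d x y s].

Section PathMetric.
Variables (X : Type) (adj : X -> X -> Prop).

Definition walk (x y : X) (n : nat) : Prop :=
  exists p : seq X, [/\ path (fun u v => `[< adj u v >]) x p,
                        last x p = y & size p = n].

Lemma walk_asbool (x y : X) (h : exists n, walk x y n) :
  exists n, `[< walk x y n >].
Proof. by case: h => n ?; exists n; apply/asboolP. Qed.

Definition path_dist : edist X := fun x y =>
  if pselect (exists n, walk x y n) is left h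
  then Some (ex_minn (walk_asbool h)) else None.

End PathMetric.

Definition schreier_adj (M X : Type) (act : M -> X -> X) (S : set M)
    (x y : X) : Prop :=
  x <> y /\ exists2 m, S m & y = act m x \/ x = act m y.

Definition schreier_dist (M X : Type) (act : M -> X -> X) (S : set M) :
  edist X := path_dist (schreier_adj act S).

Definition uniformly_bounded (X : Type) (d : edist X) (P : set (set X)) : Prop :=
  exists D : nat, forall A, P A -> forall x y, A x -> A y -> dist_le d x y D.

Definition asdim_le (X : Type) (d : edist X) (n : nat) : Prop :=
  forall s : nat, (1 <= s)%N ->
    exists P : set (set X),
      [/\ partition P id setT, uniformly_bounded d P &
          forall x, [set A | P A /\ A `&` cball d x s !=set0] #<= `I_n.+1].

(* The asymptotic dimension of an action does not depend on the finite
   generating set, so the bound is required for each of them. *)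
Definition asdim_action_le (M : nmodType) (X : Type) (act : M -> X -> X)
    (n : nat) : Prop :=
  forall S : set M, finite_set S -> generates S ->
    asdim_le (schreier_dist act S) n.

Definition N_ (r : nat) : nat := (\sum_(1 <= j < r.+1) 3 ^ j)%N.

(* Main.v *)
Require Import Defs.
From mathcomp Require Import all_boot all_order all_algebra generic_quotient.
From mathcomp Require Import boolp classical_sets functions cardinality finmap.
From mathcomp Require Import zify lra.

Set Implicit Arguments.
Unset Strict Implicit.
Unset Printing Implicit Defensive.

Import Order.TTheory GRing.Theory Num.Theory.
Local Open Scope ring_scope.

(** Let g_1, ..., g_k generate M, so that exponent vectors m in N^k act on X; by
    commutativity, points x and y are close if and only if u x = w y for small
    exponents u and w ([dist_linked], [dist_vact]).  The relations m x = n x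
    with m, n in [0, a]^k span a subspace V_a(x) of Q^k ([relspan]), which grows
    with a and along the action.  Since M has rank r, its generators satisfy
    relations spanning a subspace of dimension at least k - r, and these hold at
    every point: dim V_a(x) >= k - r for a suitable a ([rank_relspan]).

    Choose scales a_0 << a_1 << ... << a_(r+1).  The type of x is the first t
    with dim V_(a_(t+1))(x) <= k - r + t; it is at most r, and there V_(a_t)(x)
    has reached this dimension, so that V_(a_t)(x) = V_(a_(t+1))(x).  Between
    these two scales, the part of X ahead of x looks like Z^k modulo relations
    spanning V = V_(a_t)(x), a group of rank j = k - dim V <= r - t, and V is
    the same for all points of type t near x.  It is enough to divide the points
    of each type t into bounded sets, of which a ball meets at most 3^(r-t): the
    total is 1 + 3 + ... + 3^r = N_r + 1 ([bounded_labelling]).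

    In Z^k modulo V one takes a maximal set of centres that are L-separated for
    the sup norm of Q^k / V = Q^j, and sends every point to a centre within L.
    The centres used near x lie in a cube of side slightly more than 2L, which
    is covered by 3^j cubes of side L, each containing at most one centre.  The
    difficulty is that X only looks like Z^k ahead of a point: behind it X
    branches, so that the centres chosen separately around two points may come
    to clash at their common images.  The choice of centres must therefore be
    made by a rule that looks forward only.  This is where bounded-to-one
    actions are used: a point shares a forward box of given size with boundedly
    many others, so that finitely many colours tell apart the points of every
    such box ([forward_colouring]).  Centres are then selected greedily, colour
    by colour ([centre]), where the round of colour c decides, from a point x,
    about the point lying c l ahead of x in every direction; since later rounds
    are decided further ahead, all that they consult lies ahead of x.  Clashes
    modulo the rational space V reduce to clashes at distance at most l, because
    a vector that is small modulo V is small modulo the lattice of relations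
    ([lattice_rounding], [centres_separated]). *)

(** * Colouring graphs of bounded degree *)

Section Colouring.
Local Open Scope classical_set_scope.
Variables (X : eqType) (R : X -> X -> Prop).
Hypothesis R_sym : forall x y, R x y -> R y x.

Lemma maximal_independent (Y : set X) :
  exists I : set X, [/\ I `<=` Y,
    forall x y, I x -> I y -> x <> y -> ~ R x y &
    forall x, Y x -> ~ I x -> exists2 y, I y & R x y].
Proof.
pose indep (I : set X) :=
  I `<=` Y /\ forall x y, I x -> I y -> x <> y -> ~ R x y.
have [|I [[IY Iind] Imax]] := @Zorn_bigcup X indep.
  move=> F FP Ftot; split=> [x [I FI Ix]|x y [I FI Ix] [J FJ Jy]].
    exact: (FP _ FI).1 Ix.
  have [IJ|JI] := Ftot _ _ FI FJ.
    exact: (FP _ FJ).2 (IJ _ Ix) Jy.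
  exact: (FP _ FI).2 Ix (JI _ Jy).
exists I; split=> // x Yx nIx; apply: contrapT => nR.
apply: (Imax (I `|` [set x])).
  by split=> [y Iy|h]; [left|apply: nIx; apply: h; right].
split=> [y [/IY //|->//]|y z [Iy|->] [Iz|->] //].
- exact: Iind.
- by move=> _ Ryx; apply: nR; exists y => //; apply: R_sym.
- by move=> _ Rxz; apply: nR; exists z.
Qed.

(** Greedy colouring: a maximal independent set takes one colour, and its
    removal lowers by one the number of neighbours of each remaining point. *)
Lemma bounded_degree_colouring (d : nat) (Y : set X) :
  (forall x, Y x -> exists2 l : seq X, (size l <= d)%N &
    forall y, Y y -> R x y -> x <> y -> y \in l) ->
  exists2 c : X -> nat, (forall x, (c x <= d)%N) &
    forall x y, Y x -> Y y -> R x y -> c x = c y -> x = y.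
Proof.
elim: d Y => [|d IHd] Y deg.
  exists (fun=> 0%N) => // x y Yx Yy Rxy _; apply: contrapT => nxy.
  have [l + /(_ y Yy Rxy nxy)] := deg x Yx.
  by rewrite leqn0 => /nilP ->.
have [I [IY Iind Imax]] := maximal_independent Y.
have [x [Yx nIx]|c cd cP] := IHd (Y `\` I).
  have [l ld lP] := deg x Yx; have [z Iz Rxz] := Imax x Yx nIx.
  have zl : z \in l by apply: lP => //; [exact: IY|move=> xz; rewrite xz in nIx].
  exists [seq t <- l | t != z].
    rewrite -ltnS (leq_trans _ ld) // size_filter -(count_predC (pred1 z) l).
    by rewrite -[X in (X < _)%N]add0n ltn_add2r -has_count has_pred1.
  move=> y [Yy nIy] Rxy nxy; rewrite mem_filter lP // andbT.
  by apply/eqP => yz; rewrite yz in nIy.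
exists (fun x => if `[< I x >] then d.+1 else c x).
  by move=> x; case: asboolP => // _; exact: leqW.
move=> x y Yx Yy Rxy; case: asboolP => Ix; case: asboolP => Iy.
- by move=> _; apply: contrapT => nxy; exact: Iind nxy Rxy.
- by move=> e; have := cd y; rewrite -e ltnn.
- by move=> e; have := cd x; rewrite e ltnn.
- exact: cP.
Qed.

End Colouring.

(** * Rounding modulo a lattice *)

Definition vbnd (R : numDomainType) n (v : 'rV[R]_n) (c : nat) : Prop :=
  forall i, `|v 0 i| <= c%:R.

Lemma vbndW (R : numDomainType) n (v : 'rV[R]_n) c c' :
  (c <= c')%N -> vbnd v c -> vbnd v c'.
Proof. by move=> cc' vc i; rewrite (le_trans (vc i)) // ler_nat. Qed.

Lemma vbndD (R : numDomainType) n (v w : 'rV[R]_n) c c' :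
  vbnd v c -> vbnd w c' -> vbnd (v + w) (c + c').
Proof.
by move=> vc wc i; rewrite mxE natrD (le_trans (ler_normD _ _)) // lerD.
Qed.

Lemma vbndN (R : numDomainType) n (v : 'rV[R]_n) c : vbnd v c -> vbnd (- v) c.
Proof. by move=> vc i; rewrite mxE normrN. Qed.

Lemma vbndB (R : numDomainType) n (v w : 'rV[R]_n) c c' :
  vbnd v c -> vbnd w c' -> vbnd (v - w) (c + c').
Proof. by move=> vc wc; apply: vbndD vc (vbndN wc). Qed.

Notation intq := (map_mx (intr : int -> rat)).

Lemma vbnd_intq n (v : 'rV[int]_n) c : vbnd (intq v) c <-> vbnd v c.
Proof.
have h i : (`|(intq v) 0 i| <= c%:R) = (`|v 0 i| <= c%:R).
  by rewrite mxE -[RHS](ler_int rat) intr_norm natz -pmulrn.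
by split=> vc i; have := vc i; rewrite h.
Qed.

Lemma mulmx_vbnd m n (A : 'M[rat]_(m, n)) :
  exists c, forall v E, vbnd v E -> vbnd (v *m A) (c * E).
Proof.
pose s := \sum_i \sum_j `|A i j|.
have s0 : 0 <= s by apply: sumr_ge0 => i _; apply: sumr_ge0.
exists (Num.bound s) => v E vE j; rewrite mxE.
apply: (@le_trans _ _ (s * E%:R)); last first.
  by rewrite natrM ler_wpM2r ?ler0n // ltW // archi_boundP.
rewrite (le_trans (ler_norm_sum _ _ _)) // mulr_suml ler_sum // => i _.
rewrite normrM mulrC ler_pM //.
by rewrite (bigD1 j) //= lerDl sumr_ge0.
Qed.

(** Coordinates on the quotient of Q^k by the row space of V, which is the set of
    rows killed by [quomx V]; the number of columns is the dimension of the
    quotient. *)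
Definition quomx k (V : 'M[rat]_k) : 'M[rat]_(k, \rank (cokermx V)) :=
  col_base (cokermx V).

Lemma mulmx_quomx_eq0 k (V : 'M[rat]_k) n (v : 'M[rat]_(n, k)) :
  (v *m quomx V == 0) = (v <= V)%MS.
Proof.
rewrite submxE -[X in _ = (_ *m X == _)]mulmx_base mulmxA.
apply/eqP/eqP => [->|h]; first by rewrite mul0mx.
by apply: (row_free_inj (row_base_free (cokermx V))); rewrite /= mul0mx.
Qed.

(** Division with remainder by the lattice spanned by the integer rows of W: a
    vector close to the rational span of W is, modulo the lattice, a bounded
    vector.  The remainder has a bound independent of the size E of e; only the
    size of the quotient z grows with E. *)
Lemma lattice_rounding k N (W : 'M[int]_(N, k)) (V := <<intq W>>%MS) :
  exists C : nat,
   (forall e E, vbnd e E -> vbnd (e *m quomx V) (C * E)) /\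
   forall (e : 'rV[int]_k) (E L : nat), vbnd e E ->
     vbnd (intq e *m quomx V) L ->
     exists z : 'rV[int]_N,
       [/\ vbnd z (C * E + 1), vbnd (e - z *m W) (C * (L + 1)) &
           intq (e - z *m W) *m quomx V = intq e *m quomx V].
Proof.
set B := quomx V; set B' := pinvmx B.
have B'B : B' *m B = 1%:M by apply: mulVpmx; exact: col_base_full.
have [c0 c0P] := mulmx_vbnd B.
have [c1 c1P] := mulmx_vbnd ((1%:M - B *m B') *m pinvmx (intq W)).
have [c2 c2P] := mulmx_vbnd (intq W).
have [c3 c3P] := mulmx_vbnd B'.
exists (c0 + c1 + c2 + c3)%N; split=> [e E /c0P|e E L eE eL].
  by apply: vbndW; nia.
pose q := intq e *m ((1%:M - B *m B') *m pinvmx (intq W)).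
have qW : q *m intq W = intq e - intq e *m B *m B'.
  rewrite /q (mulmxA (intq e)) mulmxKpV.
    by rewrite mulmxBr mulmx1 (mulmxA (intq e) B).
  rewrite -(genmxE (intq W)) -mulmx_quomx_eq0.
  by rewrite -mulmxA mulmxBl mul1mx -mulmxA B'B mulmx1 subrr mulmx0.
pose z : 'rV[int]_N := \row_i Num.floor (q 0 i).
have fr : vbnd (q - intq z) 1.
  rewrite /z; move: (q) => u i; rewrite !mxE.
  have /andP[h1 h2] := floor_itv (u 0 i).
  rewrite ger0_norm ?subr_ge0 // lerBlDr -[1%:R]/(1%:~R) -intrD addrC.
  exact: ltW.
have zWB : intq (z *m W) *m B = 0.
  apply/eqP; rewrite mulmx_quomx_eq0 genmxE map_mxM; exact: submxMl.
exists z; split.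
- apply/vbnd_intq; rewrite -[intq z](subKr q).
  rewrite -[(_ + 1)%N]addn0; apply: (@vbndW _ _ _ (c1 * E + 1)); first by nia.
  by apply: vbndB => //; apply: c1P; apply/vbnd_intq.
- apply/vbnd_intq; rewrite map_mxB map_mxM.
  have -> : intq e - intq z *m intq W =
      (q - intq z) *m intq W + intq e *m B *m B'.
    by rewrite mulmxBl qW addrAC subrK.
  apply: (@vbndW _ _ _ (c2 * 1 + c3 * L)); first by nia.
  by apply: vbndD; [exact: c2P|exact: c3P].
- by rewrite map_mxB mulmxBl zWB subr0.
Qed.

Local Notation "v @_ i" := (fun_of_matrix v 0%R i)
  (at level 9, i at level 2, format "v  @_ i").

(** * Exponent vectors *)

Definition vle k (m : 'rV[nat]_k) (c : nat) : Prop := forall i, (m @_ i <= c)%N.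

Definition vz k (m : 'rV[nat]_k) : 'rV[int]_k := map_mx Posz m.

Lemma addvE k (m n : 'rV[nat]_k) (o : 'I_1) i : (m + n) o i = (m o i + n o i)%N.
Proof. by rewrite mxE. Qed.

Lemma vzE k (m : 'rV[nat]_k) i : (vz m) @_ i = (m @_ i)%:Z.
Proof. by rewrite mxE. Qed.

Lemma vzD k (m n : 'rV[nat]_k) : vz (m + n) = vz m + vz n.
Proof. by apply/rowP => i; rewrite !mxE. Qed.

Lemma vzBE k (m n : 'rV[nat]_k) i :
  (vz m - vz n) @_ i = (m @_ i)%:Z - (n @_ i)%:Z.
Proof. by rewrite !mxE. Qed.

Lemma subzvE k (v w : 'rV[int]_k) i : (v - w) @_ i = v @_ i - w @_ i.
Proof. by rewrite !mxE. Qed.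

Lemma addzvE k (v w : 'rV[int]_k) i : (v + w) @_ i = v @_ i + w @_ i.
Proof. by rewrite !mxE. Qed.

Lemma vle_vz k (m : 'rV[nat]_k) c : vle m c <-> vbnd (vz m) c.
Proof.
have h i : (`|(vz m) @_ i| <= c%:R) = (m @_ i <= c)%N.
  by rewrite vzE natz ger0_norm // lez_nat.
by split=> mc i; have := mc i; rewrite h.
Qed.

Lemma vleD k (m n : 'rV[nat]_k) c c' : vle m c -> vle n c' -> vle (m + n) (c + c').
Proof. by move=> mc nc i; rewrite addvE leq_add. Qed.

Lemma vleW k (m : 'rV[nat]_k) c c' : (c <= c')%N -> vle m c -> vle m c'.
Proof. by move=> cc' mc i; rewrite (leq_trans (mc i)). Qed.

Lemma vle_sum k (I : finType) (F : I -> 'rV[nat]_k) c :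
  (forall p, vle (F p) c) -> vle (\sum_p F p) (#|I| * c).
Proof.
move=> Fc; rewrite -sum_nat_const.
by apply: (big_ind2 (@vle k)) => // [i|m u n v mu nv]; [rewrite mxE|exact: vleD].
Qed.

Lemma const_vE k (c : nat) i : (const_mx c : 'rV_k) @_ i = c.
Proof. exact: mxE. Qed.

Lemma vle_const k c : vle (const_mx c : 'rV_k) c.
Proof. by move=> i; rewrite mxE. Qed.

Lemma vbnd_intP k (v : 'rV[int]_k) (c : nat) :
  vbnd v c <-> forall i, - c%:Z <= v @_ i <= c%:Z.
Proof. by split=> vc i; have := vc i; rewrite ler_norml natz. Qed.

Definition box k a := {ffun 'I_k -> 'I_a.+1}.

Definition bvec k a (b : box k a) : 'rV[nat]_k := \row_i (b i : nat).

Lemma bvec_le k a (b : box k a) : vle (bvec b) a.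
Proof. by move=> i; rewrite mxE -ltnS. Qed.

Lemma bvec_onto k a (m : 'rV[nat]_k) : vle m a -> exists b : box k a, bvec b = m.
Proof.
move=> ma; exists [ffun i => inord (m @_ i)].
by apply/rowP => i; rewrite mxE ffunE inordK // ltnS.
Qed.

(** The differences of the pairs of vectors in R, as the rows of a matrix; the
    pairs outside R contribute zero rows, so that all the R of one scale a
    share a matrix size. *)
Definition diffmx k a (R : {set box k a * box k a}) :
    'M[int]_(#|{: box k a * box k a}|, k) :=
  \matrix_p let q := enum_val p in
    if q \in R then vz (bvec q.1) - vz (bvec q.2) else 0.

(** * Relations between exponents at a point *)

Lemma fin_bound (I : finType) (P : I -> nat -> Prop) :
  (forall i m n, (m <= n)%N -> P i m -> P i n) ->
  (forall i, exists n, P i n) -> exists n, forall i, P i n.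
Proof.
move=> Pmono /choice[f fP]; exists (\max_i f i)%N => i.
by apply: Pmono (fP i); rewrite (leq_bigmax i).
Qed.

Section Dynamics.
Variables (k : nat) (X : eqType) (act : 'rV[nat]_k -> X -> X).
Hypothesis actD : forall m n x, act (m + n) x = act m (act n x).
Implicit Types (m n : 'rV[nat]_k) (x y : X) (a : nat).

Lemma act_comm m n x : act m (act n x) = act n (act m x).
Proof. by rewrite -!actD addrC. Qed.

Lemma act_eqD m n m' n' x :
  act m x = act n x -> act m' x = act n' x -> act (m + m') x = act (n + n') x.
Proof. by move=> e e'; rewrite actD e' act_comm e -actD addrC. Qed.

Lemma act_eqMn m n x c : act m x = act n x -> act (m *+ c) x = act (n *+ c) x.
Proof. by move=> e; elim: c => // c IHc; rewrite !mulrS; apply: act_eqD. Qed.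

Definition rels a x : {set box k a * box k a} :=
  [set p | act (bvec p.1) x == act (bvec p.2) x].

Lemma in_rels a x p : (p \in rels a x) = (act (bvec p.1) x == act (bvec p.2) x).
Proof. by rewrite /rels inE. Qed.

(** The choice of a canonical basis by [<< >>] makes equal spans equal matrices,
    so that points with the same span share the coordinates [quomx]. *)
Definition relspan a x : 'M[rat]_k := <<intq (diffmx (rels a x))>>%MS.

Lemma sub_relspan a x m n : vle m a -> vle n a -> act m x = act n x ->
  (intq (vz m - vz n) <= relspan a x)%MS.
Proof.
move=> /bvec_onto[b <-] /bvec_onto[c <-] e.
rewrite genmxE; have -> : intq (vz (bvec b) - vz (bvec c)) =
    row (enum_rank (b, c)) (intq (diffmx (rels a x))).
  rewrite -map_row; congr map_mx.
  by rewrite rowK enum_rankK /= in_rels e eqxx.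
exact: row_sub.
Qed.

Lemma relspan_sub a x (U : 'M[rat]_k) :
  (forall m n, vle m a -> vle n a -> act m x = act n x ->
     (intq (vz m - vz n) <= U)%MS) -> (relspan a x <= U)%MS.
Proof.
move=> h; rewrite genmxE; apply/row_subP => p.
rewrite -map_row rowK /=; case: ifP => [|_]; last by rewrite map_mx0 sub0mx.
by rewrite in_rels => /eqP e; apply: h => //; exact: bvec_le.
Qed.

Lemma relspan_mono a b x : (a <= b)%N -> (relspan a x <= relspan b x)%MS.
Proof.
move=> ab; apply: relspan_sub => m n ma na.
by apply: sub_relspan; [exact: vleW ab ma|exact: vleW ab na].
Qed.

Lemma relspan_act a m x : (relspan a x <= relspan a (act m x))%MS.
Proof.
apply: relspan_sub => n p na pa e; apply: sub_relspan => //.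
by rewrite act_comm e act_comm.
Qed.

Lemma relspan_actD a c m x : vle m c -> (relspan a (act m x) <= relspan (a + c) x)%MS.
Proof.
move=> mc; apply: relspan_sub => n p na pa; rewrite -!actD => e.
have -> : vz n - vz p = vz (n + m) - vz (p + m).
  by rewrite !vzD opprD addrACA subrr addr0.
by apply: sub_relspan => //; exact: vleD.
Qed.

(** Integer combinations of relations at x are again relations, as soon as the
    exponents leave room for them: n1 has to dominate, in each coordinate, the
    sum of the left-hand sides of all the relations used. *)
Lemma act_eq_lattice a x Q (z : 'rV[int]_#|{: box k a * box k a}|) n1 n2 :
  vbnd z Q -> vz n1 - vz n2 = z *m diffmx (rels a x) ->
  (forall i, (#|{: box k a * box k a}| * (Q * a) <= n1 @_ i)%N) ->
  act n1 x = act n2 x.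
Proof.
move=> zQ e n1_big.
pose zp p : nat := if 0 <= z @_ p then `|z @_ p|%N else 0%N.
pose zm p : nat := if 0 <= z @_ p then 0%N else `|z @_ p|%N.
pose g1 := \sum_p let q := enum_val p in if q \in rels a x then
  bvec q.1 *+ zp p + bvec q.2 *+ zm p else 0.
pose g2 := \sum_p let q := enum_val p in if q \in rels a x then
  bvec q.2 *+ zp p + bvec q.1 *+ zm p else 0.
have g12 : act g1 x = act g2 x.
  apply: (big_ind2 (fun m n => act m x = act n x)) => //.
    by move=> m m' n n' e1 e2; apply: act_eqD.
  move=> p _ /=; case: ifP => //; rewrite in_rels => /eqP ep.
  by apply: act_eqD; apply: act_eqMn.
have natMn (u v : nat) : u *+ v = (u * v)%N by rewrite -mulr_natr natn.
have g1n i : (g1 @_ i <= n1 @_ i)%N.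
  apply: leq_trans (n1_big i); move: i.
  rewrite -[X in (X * _)%N]card_ord; apply: vle_sum => p i /=.
  case: ifP => _; last by rewrite mxE.
  rewrite addvE !mulmxnE !natMn.
  have zpm : (zp p + zm p <= Q)%N.
    by have /vbnd_intP/(_ p) := zQ; rewrite /zp /zm; case: ifP; lia.
  rewrite (leq_trans _ (leq_mul zpm (leqnn a))) // mulnDl mulnC [X in (_ + X)%N]mulnC.
  by apply: leq_add; rewrite leq_mul2l; apply/orP; right; exact: bvec_le.
pose r : 'rV[nat]_k := \row_i (n1 @_ i - g1 @_ i)%N.
have n1E : n1 = r + g1 by apply/rowP => i; rewrite addvE mxE subnK.
have g12z : vz g1 - vz g2 = z *m diffmx (rels a x).
  apply/rowP => i; rewrite !mxE !summxE !(big_morph Posz PoszD (erefl _)).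
  rewrite -sumrB; apply: eq_bigr => p _; rewrite mxE /=.
  case: ifP => _; last by rewrite !mxE mulr0 subrr.
  pose b := bvec (enum_val p).1; pose c := bvec (enum_val p).2.
  transitivity ((b @_ i * zp p + c @_ i * zm p)%N%:Z -
                (c @_ i * zp p + b @_ i * zm p)%N%:Z).
    by congr (Posz _ - Posz _); rewrite addvE !mulmxnE !natMn.
  by rewrite -/b -/c; move: b c => b c; rewrite !mxE /zp /zm; case: ifP; nia.
have -> : n2 = r + g2.
  have shift (u v w t : nat) :
    (w <= u)%N -> u%:Z - v%:Z = w%:Z - t%:Z -> v = (u - w + t)%N by lia.
  apply/rowP => i; have := congr1 (fun v : 'rV_k => v @_ i) e.
  by rewrite -g12z !vzBE addvE mxE => /(shift _ _ _ _ (g1n i)).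
by rewrite n1E !actD g12.
Qed.

Hypothesis bto : forall m, exists c : nat, forall y,
  exists2 l : seq X, (size l <= c)%N & forall x, act m x = y -> x \in l.

(** * Centres *)

(** Points that occur in a common forward box of side r get different colours;
    each point lies in boundedly many such boxes since the action is
    bounded-to-one. *)
Lemma forward_colouring r : exists K (col : X -> nat), (forall x, (col x < K)%N) /\
  forall x m n, vle m r -> vle n r ->
    col (act m x) = col (act n x) -> act m x = act n x.
Proof.
pose R w w' := exists x m n, [/\ vle m r, vle n r, act m x = w & act n x = w'].
have Rsym w w' : R w w' -> R w' w.
  by case=> x [m [n [mr nr e e']]]; exists x, n, m.
have [c cP] : exists c, forall b : box k r, forall y,
    exists2 l : seq X, (size l <= c)%N & forall x, act (bvec b) x = y -> x \in l.
  apply: fin_bound => [b m n mn h y|b]; last exact: bto.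
  by have [l lm lP] := h y; exists l => //; exact: leq_trans lm mn.
have [|col colK colP] := @bounded_degree_colouring X R Rsym
    (#|box k r| * c * #|box k r|)%N classical_sets.setT.
  move=> w _; have /choice[L LP] : forall b : box k r, exists l : seq X,
      (size l <= c)%N /\ forall x, act (bvec b) x = w -> x \in l.
    by move=> b; have [l] := cP b w; exists l.
  pose pre := flatten [seq L b | b <- enum (box k r)].
  exists [seq act (bvec b) x | x <- pre, b <- enum (box k r)].
    rewrite size_allpairs -cardE leq_mul2r; apply/orP; right.
    rewrite size_flatten /shape -map_comp sumnE big_map -sum_nat_const big_enum.
    by rewrite leq_sum // => b _; case: (LP b).
  move=> y _ [x [m [n [/bvec_onto[b <-] /bvec_onto[b' <-] e <-]]]] _.
  apply/allpairsP; exists (x, b') => /=; split=> //; last by rewrite mem_enum.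
  apply/flatten_mapP; exists b; first by rewrite mem_enum.
  exact: (LP b).2.
exists (#|box k r| * c * #|box k r|).+1%N, col; split=> // x m n mr nr.
by apply: colP => //; exists x, m, n.
Qed.

(** Rounding modulo the relations at x, with a constant C independent of x: at a
    given scale there are only finitely many sets of relations. *)
Lemma relation_rounding a : exists C, forall x,
  (forall e E, vbnd e E -> vbnd (e *m quomx (relspan a x)) (C * E)) /\
  forall (e : 'rV[int]_k) (E L : nat), vbnd e E ->
    vbnd (intq e *m quomx (relspan a x)) L ->
    exists d : 'rV[int]_k,
      [/\ vbnd d (C * (L + 1)),
          intq d *m quomx (relspan a x) = intq e *m quomx (relspan a x) &
          forall n1 n2, vz n1 - vz n2 = e - d ->
            (forall i, C * (E + 1) <= n1 @_ i)%N -> act n1 x = act n2 x].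
Proof.
pose N := #|{: box k a * box k a}|.
have [C CP] : exists C, forall R : {set box k a * box k a},
   let V := <<intq (diffmx R)>>%MS in
   (forall e E, vbnd e E -> vbnd (e *m quomx V) (C * E)) /\
   forall (e : 'rV[int]_k) (E L : nat), vbnd e E ->
     vbnd (intq e *m quomx V) L ->
     exists z : 'rV[int]_N,
       [/\ vbnd z (C * E + 1), vbnd (e - z *m diffmx R) (C * (L + 1)) &
           intq (e - z *m diffmx R) *m quomx V = intq e *m quomx V].
  apply: fin_bound => [R m n mn [h1 h2]|R]; last exact: lattice_rounding.
  split=> [e E eE|e E L eE eL].
    by apply: vbndW (h1 e E eE); rewrite leq_mul2r mn orbT.
  have [z [z1 z2 z3]] := h2 e E L eE eL; exists z; split=> //.
    by apply: vbndW z1; rewrite leq_add2r leq_mul2r mn orbT.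
  by apply: vbndW z2; rewrite leq_mul2r mn orbT.
exists (C + N * ((C + 1) * a))%N => x.
have [h1 h2] := CP (rels a x); split=> [e E eE|e E L eE eL].
  by apply: vbndW (h1 e E eE); rewrite leq_mul2r leq_addr orbT.
have [z [zE dL dV]] := h2 e E L eE eL.
exists (e - z *m diffmx (rels a x)); split=> //.
  by apply: vbndW dL; rewrite leq_mul2r leq_addr orbT.
move=> n1 n2; rewrite subKr => e12 n1_big.
apply: (act_eq_lattice zE e12) => i; apply: leq_trans (n1_big i).
rewrite -/N [leqRHS]mulnDl; apply: leq_trans (leq_addl _ _).
rewrite -mulnA leq_mul2l mulnAC leq_mul2r; apply/orP; right; apply/orP; right.
by nia.
Qed.

Notation cst c := (const_mx c : 'rV[nat]_k).

Section Centres.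
Variables (a L l : nat) (col : X -> nat).

(** A point x takes part in the round of colour c through the point c l x ahead
    of it; [gap m c c'] is the displacement from the point concerned by x in
    round c' to the point concerned by m x in round c. *)
Definition gap m c c' : 'rV[int]_k := vz (m + cst (c * l)%N) - vz (cst (c' * l)%N).

Definition close x m c c' : Prop :=
  vbnd (gap m c c') l /\ vbnd (intq (gap m c c') *m quomx (relspan a x)) L.

(** [centres_below n c x]: in one of the rounds before n, namely that of colour
    c, the point c l x is made a centre on behalf of x.  This happens if its
    colour is c, unless a centre of an earlier round lies close to it.  The
    table of the rounds before n makes the recursion structural; [centreP] is
    the intended equation. *)
Fixpoint centres_below (n : nat) (c : nat) (x : X) : Prop :=
  if n is n'.+1 then
    centres_below n' c x \/
    [/\ c = n', col (act (cst (n' * l)%N) x) = n' &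
        forall c' m, close x m c' n' -> ~ centres_below n' c' (act m x)]
  else False.

Definition centre c x := centres_below c.+1 c x.

Lemma centres_belowP (n : nat) c x : centres_below n c x <-> (c < n)%N /\ centre c x.
Proof.
elim: n => [|n IHn]; first by split=> // -[].
split=> [/= [/IHn[cn h]|[-> h1 h2]]|[]].
- by split=> //; exact: leqW.
- by split=> //; right.
- rewrite ltnS leq_eqVlt => /orP[/eqP -> //|cn] h.
  by left; apply/IHn.
Qed.

Lemma centreP c x : centre c x <->
  col (act (cst (c * l)%N) x) = c /\
  forall c' m, (c' < c)%N -> close x m c' c -> ~ centre c' (act m x).
Proof.
split=> [/= [/centres_belowP[]|[_ h1 h2]]|[h1 h2]].
- by rewrite ltnn.
- by split=> // c' m c'c /h2 h h'; apply: h; apply/centres_belowP.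
- right; split=> // c' m h /centres_belowP[c'c]; exact: h2.
Qed.

(** Maximality: when the round of its colour comes, the point K l x either becomes
    a centre or is refused because of a close one. *)
Lemma centre_near K x : (forall y, (col y < K)%N) ->
  (forall m, vle m (K * l) -> relspan a (act m x) = relspan a x) ->
  exists c m, [/\ (c < K)%N, centre c (act m x) & close x m c K].
Proof.
move=> colK xV; pose c := col (act (cst (K * l)%N) x).
have cK : (c < K)%N by exact: colK.
pose m0 := cst ((K - c) * l)%N; pose x' := act m0 x.
have x'V : relspan a x' = relspan a x.
  apply: xV; apply: (@vleW _ _ ((K - c) * l)%N); last exact: vle_const.
  by rewrite leq_mul2r leq_subr orbT.
have colx' : col (act (cst (c * l)%N) x') = c.
  rewrite -actD; congr (col (act _ x)); apply/rowP => i.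
  by rewrite addvE !mxE -mulnDl subnKC // ltnW.
have gap0 m c' : gap (m + m0) c' K = gap m c' c.
  have cl_le : (c * l <= K * l)%N by rewrite leq_mul2r ltnW ?orbT.
  by apply/rowP => i; rewrite /gap !vzBE !addvE !mxE mulnBl; lia.
have [cx'|ncx'] := pselect (centre c x').
  exists c, m0; split=> //; rewrite /close -[m0]add0r gap0 /gap add0r subrr.
  split; first by move=> i; rewrite mxE normr0.
  by move=> i; rewrite map_mx0 mul0mx mxE normr0.
have [c' [m [c'c cl cm]]] : exists c' m,
    [/\ (c' < c)%N, close x' m c' c & centre c' (act m x')].
  apply: contrapT => h; apply: ncx'; apply/centreP; split=> // c' m c'c cl cm.
  by apply: h; exists c', m.
exists c', (m + m0); split; first exact: ltn_trans cK.
  by rewrite actD.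
by move: cl; rewrite /close gap0 x'V.
Qed.

End Centres.

(** Two centres seen from x whose positions agree up to L modulo the relations
    coincide: modulo relations their displacement becomes small, so that either
    the one of larger colour was excluded by the other one, or they have the
    same colour and are close, hence equal. *)
Lemma centres_separated a C L E col x (l := (C * (L + 1))%N) :
  (forall (e : 'rV[int]_k) (E L : nat), vbnd e E ->
    vbnd (intq e *m quomx (relspan a x)) L ->
    exists d : 'rV[int]_k,
      [/\ vbnd d (C * (L + 1)),
          intq d *m quomx (relspan a x) = intq e *m quomx (relspan a x) &
          forall n1 n2, vz n1 - vz n2 = e - d ->
            (forall i, C * (E + 1) <= n1 @_ i)%N -> act n1 x = act n2 x]) ->
  (forall y m n, vle m (2 * l) -> vle n (2 * l) ->
    col (act m y) = col (act n y) -> act m y = act n y) ->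
  forall c1 m1 c2 m2,
    relspan a (act m1 x) = relspan a x -> relspan a (act m2 x) = relspan a x ->
    centre a L l col c1 (act m1 x) -> centre a L l col c2 (act m2 x) ->
    (forall i, C * (E + 1) + l <= m1 @_ i)%N ->
    (forall i, C * (E + 1) + l <= m2 @_ i)%N ->
    let e := vz (m1 + cst (c1 * l)%N) - vz (m2 + cst (c2 * l)%N) in
    vbnd e E -> vbnd (intq e *m quomx (relspan a x)) L ->
    act (m1 + cst (c1 * l)%N) x = act (m2 + cst (c2 * l)%N) x.
Proof.
move=> rounding colP c1 m1 c2 m2.
wlog: c1 m1 c2 m2 / (c1 <= c2)%N => [wlog_le V1 V2 h1 h2 g1 g2 /= eE eL|].
  have [c12|/ltnW c21] := leqP c1 c2; first exact: wlog_le.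
  apply/esym/wlog_le => //; first by rewrite -opprB; exact: vbndN.
  by rewrite -opprB map_mxN mulNmx; exact: vbndN.
move=> c12 V1 V2 h1 h2 g1 g2 e eE eL.
have [d [dl dV dP]] := rounding e E L eE eL.
have /vbnd_intP dl' := dl.
case: (ltngtP c1 c2) c12 => // [c12 _|c12 _].
  have cl : (c1 * l + l <= c2 * l)%N by rewrite addnC -mulSn leq_mul2r c12 orbT.
  pose m : 'rV[nat]_k := \row_i `|((c2 * l)%N%:Z - (c1 * l)%N%:Z + d @_ i)%R|%N.
  have mE i : (m @_ i)%:Z = (c2 * l)%N%:Z - (c1 * l)%N%:Z + d @_ i.
    by rewrite mxE; have := dl' i; rewrite -/l; lia.
  have gapE : gap l m c1 c2 = d.
    by apply/rowP => i; rewrite /gap vzBE addvE PoszD mE !mxE; lia.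
  have m12 : act m (act m2 x) = act m1 x.
    rewrite -actD; apply/esym/dP => [|i]; last by apply: leq_trans (g1 i); lia.
    apply/rowP => i; rewrite /e vzBE subzvE vzBE !addvE !PoszD mE.
    by rewrite !const_vE; lia.
  have /centreP[_ /(_ c1 m c12)] := h2; rewrite m12 => excl.
  case: (excl _ h1); rewrite /close gapE V2; split=> //.
  by rewrite dV.
move: h1 h2; rewrite -/l; subst c2.
move=> /centreP[k1 _] /centreP[k2 _].
pose p1 : 'rV[nat]_k := m1 + cst (c1 * l)%N.
pose p2 : 'rV[nat]_k := m2 + cst (c1 * l)%N.
pose q : 'rV[nat]_k := \row_i (p2 @_ i - l)%N.
pose r : 'rV[nat]_k := \row_i `|(l%:Z + d @_ i)%R|%N.
have rE i : (r @_ i)%:Z = l%:Z + d @_ i.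
  by rewrite mxE; have := dl' i; rewrite -/l; lia.
have p2_ge i : (l <= p2 @_ i)%N.
  by rewrite /p2 addvE (leq_trans _ (leq_addr _ _)) // (leq_trans _ (g2 i)) ?leq_addl.
have p2E : p2 = cst l + q.
  by apply/rowP => i; rewrite [RHS]addvE !const_vE [q @_ i]mxE subnKC.
have qE i : (q @_ i)%:Z = (p2 @_ i)%:Z - l%:Z.
  by rewrite [q @_ i]mxE subzn.
have p1E : act p1 x = act (r + q) x.
  apply: dP => [|i].
    apply/rowP => i; rewrite vzBE /e -/p1 -/p2 subzvE vzBE (addvE r q) PoszD.
    by rewrite rE qE; lia.
  by rewrite /p1 addvE; apply: leq_trans (leq_addr _ _); apply: leq_trans (g1 i); lia.
rewrite -/p1 -/p2 p1E p2E !actD; apply: colP.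
- move=> i; have := rE i; have := dl' i; rewrite -/l; lia.
- by move=> i; rewrite mxE leq_pmull.
- rewrite -!actD -p1E -p2E /p1 /p2 [m1 + _]addrC [m2 + _]addrC !actD.
  by rewrite k1 k2.
Qed.

(** * Points with stable relations *)

Lemma relspan_eq a b x y : (relspan a x <= relspan b y)%MS ->
  (relspan b y <= relspan a x)%MS -> relspan a x = relspan b y.
Proof.
move=> h1 h2; rewrite -[LHS]genmx_id -[RHS]genmx_id; apply/genmxP.
by rewrite h1 h2.
Qed.

Definition stable a b x : Prop := relspan a x = relspan b x.

Lemma stable_rank a b x : (a <= b)%N ->
  (\rank (relspan b x) <= \rank (relspan a x))%N -> stable a b x.
Proof.
move=> ab rk; have sub := relspan_mono x ab; apply: relspan_eq => //.
by have := mxrank_leqif_sup sub => /leqifP; case: ifP => // _; rewrite ltnNge rk.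
Qed.

(** Moving ahead can only add relations, and those it adds are relations at the
    original point for a larger scale. *)
Lemma stable_act a b c m x : stable a b x -> (a + c <= b)%N -> vle m c ->
  relspan a (act m x) = relspan a x.
Proof.
move=> st acb mc; apply: relspan_eq; last exact: relspan_act.
by apply: submx_trans (relspan_actD _ _ mc) _; rewrite st; apply: relspan_mono.
Qed.

Definition linked s x y : Prop :=
  exists u w, [/\ vle u s, vle w s & act u x = act w y].

(** The third of the interval [-3c, 3c] that contains t. *)
Definition digit (c : nat) (t : rat) : 'I_3 :=
  if t <= - c%:R then inord 0 else if t <= c%:R then inord 1 else inord 2.

Lemma digit_close c t u : `|t| <= (3 * c)%:R -> `|u| <= (3 * c)%:R ->
  digit c t = digit c u -> `|t - u| <= (2 * c)%:R.
Proof.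
rewrite /digit !natrM !ler_norml => /andP[t1 t2] /andP[u1 u2] /(congr1 val).
case: (lerP t (- c%:R)) => ?; case: (lerP u (- c%:R)) => ? /=;
  try case: (lerP t c%:R) => ? /=; try case: (lerP u c%:R) => ? /=;
  by rewrite ?inordK // => _; apply/andP; split; lra.
Qed.

(** The division of the points whose relations are stable between the scales a
    and b: each such point goes to a centre A y ahead of it, and the centres
    used near x are told apart by the cell that contains them, among the 3^j
    cells of a cube in the quotient by the relations, of dimension j. *)
Lemma scale_step a s : exists b A D,
  [/\ (a <= b)%N,
      forall y, stable a b y -> exists2 n, vle n D & A y = act n y &
      forall x, stable a b x -> exists code : X -> nat,
        (forall y, code y < 3 ^ (k - \rank (relspan a x)))%N /\
        forall y1 y2, stable a b y1 -> stable a b y2 ->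
          linked s x y1 -> linked s x y2 -> code y1 = code y2 -> A y1 = A y2].
Proof.
have [C rounding] := relation_rounding a.
(* Points linked to x differ from it by at most 2 s in the exponents, hence by
   at most c0 in the quotient: their centres lie within L + c0 = 3 c0, and two
   of them in the same third of this range are within 2 c0 = L. *)
pose c0 := (C * (2 * s))%N; pose L := (2 * c0)%N.
pose l := (C * (L + 1))%N.
have [K [col [colK colP]]] := forward_colouring (2 * l).
(* The number K of colours depends on l only, so that the extent T of what is
   looked at, which depends on K, can be fixed afterwards. *)
pose E := (2 * (l + 2 * s))%N.
(* Moving t ahead first makes room for the relations used in rounding. *)
pose t := (C * (E + 1) + l + s)%N.
pose T := (K * l + l + t + s)%N.
pose b := (a + T)%N.
have ab : (a <= b)%N by rewrite leq_addr.
have stT c m y : stable a b y -> (c <= T)%N -> vle m c ->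
    relspan a (act m y) = relspan a y.
  by move=> st cT mc; apply: (stable_act st) mc; rewrite leq_add2l.
have /choice[f fP] y : exists cm : nat * 'rV[nat]_k, stable a b y ->
    [/\ (cm.1 < K)%N, centre a L l col cm.1 (act cm.2 (act (cst t) y)) &
        close a L l (act (cst t) y) cm.2 cm.1 K].
  have [st|nst] := pselect (stable a b y); last by exists (0%N, 0).
  have [|c [m [cK h1 h2]]] := @centre_near a L l col K (act (cst t) y) colK.
    move=> m mK; rewrite -actD; have mt := vleD mK (@vle_const k t).
    rewrite (stT _ _ _ st _ mt); last by rewrite /T; lia.
    by rewrite (stT _ _ _ st _ (@vle_const k t)) // /T; lia.
  by exists (c, m).
exists b, (fun y => act ((f y).2 + cst ((f y).1 * l)%N + cst t) y), (K * l + l + t)%N.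
have fle y : stable a b y -> vle ((f y).2 + cst ((f y).1 * l)%N) (K * l + l).
  move=> /fP[_ _ [/vbnd_intP gl _]] i; have := gl i.
  by rewrite /gap vzBE const_vE; lia.
split=> // [y st|x stx].
  exists ((f y).2 + cst ((f y).1 * l)%N + cst t) => //.
  by apply: vleD; [exact: fle|exact: vle_const].
pose V := relspan a x; have [imP roundP] := rounding x.
(* the exponents taking x, instead of y, to the centre of y *)
pose P y (m : 'rV[nat]_k) := [/\ relspan a (act m x) = V,
  centre a L l col (f y).1 (act m x),
  (forall i, C * (E + 1) + l <= m @_ i)%N,
  act ((f y).2 + cst ((f y).1 * l)%N + cst t) y = act (m + cst ((f y).1 * l)%N) x &
  let e := vz (m + cst ((f y).1 * l)%N) - vz (cst (K * l + t)%N) in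
  vbnd e (l + 2 * s) /\ vbnd (intq e *m quomx V) (3 * c0)].
have /choice[g gP] y : exists m, stable a b y -> linked s x y -> P y m.
  have [[sty [u [w [us ws uw]]]]|n] := pselect (stable a b y /\ linked s x y);
    last first.
    by exists 0 => sty lxy; case: n.
  have [cK cen [gl gL]] := fP y sty.
  have yV : relspan a (act (cst t) y) = V.
    rewrite (stT _ _ _ sty _ (@vle_const k t)); last by rewrite /T; lia.
    have sT : (s <= T)%N by rewrite /T; lia.
    by rewrite -(stT _ _ _ sty sT ws) -uw (stT _ _ _ stx sT us).
  pose w' : 'rV[nat]_k := \row_i (t - w @_ i)%N.
  have w'E i : w' @_ i = (t - w @_ i)%N by rewrite mxE.
  have ww' : cst t = w' + w.
    apply/rowP => i; rewrite addvE const_vE w'E subnK // (leq_trans (ws i)) // /t.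
    by lia.
  pose c := (f y).1; pose m := (f y).2; pose M : 'rV[nat]_k := m + w' + u.
  have ME : act m (act (cst t) y) = act M x.
    by rewrite /M ww' !actD -uw.
  have MV : relspan a (act M x) = V.
    rewrite -ME -actD (stT _ _ _ sty (leqnn _)) //.
      rewrite -[relspan a y](stT _ _ _ sty _ (@vle_const k t)) //.
      by rewrite /T; lia.
    apply: (@vleW _ _ (K * l + l + t)%N); first by rewrite /T; lia.
    apply: vleD; last exact: vle_const.
    by move=> i; have := fle y sty i; rewrite addvE; apply: leq_trans (leq_addr _ _).
  have eE : vz (M + cst (c * l)%N) - vz (cst (K * l + t)%N) =
      gap l m c K + (vz u - vz w).
    apply/rowP => i; rewrite [RHS]addzvE /gap !vzBE !addvE !const_vE w'E.
    by have := ws i; rewrite /t; lia.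
  have uwb : vbnd (vz u - vz w) (2 * s).
    by rewrite mul2n -addnn; apply: vbndB; apply/vle_vz.
  exists M => _ _; split=> //; first by rewrite -ME.
  - move=> i; rewrite /M !addvE w'E; have := ws i; rewrite /t; lia.
  - transitivity (act (cst (c * l)%N) (act M x)); last by rewrite -actD addrC.
    by rewrite -ME -!actD; congr (act _ y); rewrite -addrA addrCA ?addrA.
  rewrite /= -/c eE; split; first exact: vbndD.
  rewrite map_mxD mulmxDl (_ : 3 * c0 = L + c0)%N; last by rewrite /L; lia.
  by apply: vbndD; [rewrite -yV|apply: imP; apply/vbnd_intq].
pose e y := vz (g y + cst ((f y).1 * l)%N) - vz (cst (K * l + t)%N).
pose cell y : {ffun 'I_(\rank (cokermx V)) -> 'I_3} :=
  [ffun i => digit c0 ((intq (e y) *m quomx V) 0 i)].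
exists (fun y => nat_of_ord (enum_rank (cell y))).
split=> [y|y1 y2 st1 st2 l1 l2 /val_inj].
  have cardE : #|{: {ffun 'I_(\rank (cokermx V)) -> 'I_3}}| =
      (3 ^ (k - \rank V))%N.
    by rewrite card_ffun !card_ord mxrank_coker.
  by rewrite -cardE; exact: ltn_ord.
move=> /enum_rank_inj cells.
have [V1 cen1 big1 -> /= [E1 L1]] := gP y1 st1 l1.
have [V2 cen2 big2 -> /= [E2 L2]] := gP y2 st2 l2.
have e12 : vz (g y1 + cst ((f y1).1 * l)%N) - vz (g y2 + cst ((f y2).1 * l)%N) =
    e y1 - e y2.
  by rewrite /e opprB addrA subrK.
apply: (centres_separated (C := C) (L := L) (E := E) roundP colP) => //.
  by rewrite e12 /E mul2n -addnn; apply: vbndB.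
rewrite e12 map_mxB mulmxBl => i; rewrite mxE [X in _ + X]mxE.
apply: digit_close (L1 i) (L2 i) _.
by have := congr1 (fun c : {ffun _} => c i) cells; rewrite !ffunE.
Qed.

(** * Types of points *)

Lemma linked_trans s x y z : linked s x y -> linked s x z -> linked (2 * s) y z.
Proof.
move=> [u [w [us ws e]]] [u' [w' [u's w's e']]].
exists (u' + w), (u + w'); rewrite mul2n -addnn; split; try exact: vleD.
by rewrite !actD -e -e' act_comm.
Qed.

(** The type of a point is the first t such that the rank of its relations at
    scale t + 1 is at most k - r + t.  At scale t it was at least that, by
    minimality or, for t = 0, by hypothesis: the relations are stable, and the
    quotient has dimension at most r - t. *)
Lemma bounded_labelling a0 r s :
  (forall x, k <= r + \rank (relspan a0 x))%N ->
  exists (lab : X -> nat * X) D,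
    (forall y, exists2 n, vle n D & (lab y).2 = act n y) /\
    forall x, exists code : X -> nat,
      (forall y, code y < \sum_(t < r.+1) 3 ^ (r - t))%N /\
      forall y1 y2, linked s x y1 -> linked s x y2 -> code y1 = code y2 ->
        lab y1 = lab y2.
Proof.
move=> rank_a0.
have /choice[nb /choice[nA /choice[nD step]]] := fun a => scale_step a (2 * s).
pose sc t := iter t nb a0.
have ty_ex x : exists t, (\rank (relspan (sc t.+1) x) <= k - r + t)%N.
  by exists r; rewrite (leq_trans (rank_leq_col _)) //; lia.
pose ty x := ex_minn (ty_ex x).
have tyP x : [/\ (ty x <= r)%N, stable (sc (ty x)) (sc (ty x).+1) x &
    (k - \rank (relspan (sc (ty x)) x) <= r - ty x)%N].
  rewrite /ty; case: ex_minnP => t rk_t tmin.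
  have tr : (t <= r)%N.
    by apply: tmin; rewrite (leq_trans (rank_leq_col _)) //; lia.
  have rk_ge : (k - r + t <= \rank (relspan (sc t) x))%N.
    case: (t) tmin => [_|u umin]; first by have := rank_a0 x; rewrite /sc /=; lia.
    by rewrite addnS ltnNge; apply/negP => /umin; rewrite ltnn.
  split=> //; last by lia.
  by apply: stable_rank; [case: (step (sc t))|exact: leq_trans rk_t rk_ge].
pose lab y := (ty y, nA (sc (ty y)) y).
(* The codes of type t occupy an interval of length 3^(r-t) starting at off t. *)
pose off t := (\sum_(i < t) 3 ^ (r - i))%N.
have offS t : off t.+1 = (off t + 3 ^ (r - t))%N by rewrite /off big_ord_recr.
have off_mono t u : (t <= u)%N -> (off t <= off u)%N.
  move=> /subnK <-; elim: (u - t)%N => // d IHd.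
  by rewrite addSn offS (leq_trans IHd) // leq_addr.
exists lab, (\max_(t < r.+1) nD (sc t))%N; split=> [y|x].
  have [tr st _] := tyP y; have [_ AD _] := step (sc (ty y)).
  have [n nle nE] := AD y st; exists n => //; apply: vleW nle.
  exact: (leq_bigmax (F := fun t : 'I_r.+1 => nD (sc t))
    (Ordinal (tr : (_ < r.+1)%N))).
have /choice[code codeP] t : exists code : X -> nat,
    (forall y, (code y < 3 ^ (r - t))%N) /\
    forall y1 y2, linked s x y1 -> linked s x y2 -> ty y1 = t -> ty y2 = t ->
      code y1 = code y2 -> lab y1 = lab y2.
  (* The base point x may have another type; any point x0 of type t near x
     serves in its place, at twice the distance. *)
  have [[x0 [lx0 tx0]]|none] := pselect (exists x0, linked s x x0 /\ ty x0 = t);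
    last first.
    exists (fun=> 0%N); split=> [y|y1 y2 l1 _ t1]; first by rewrite expn_gt0.
    by case: none; exists y1.
  have [_ st0 rk0] := tyP x0; rewrite tx0 in st0 rk0.
  have [_ _ /(_ x0 st0)[code [code_lt codeP]]] := step (sc t).
  exists code; split=> [y|y1 y2 l1 l2 t1 t2 e12].
    by rewrite (leq_trans (code_lt y)) // leq_pexp2l.
  have [_ st1 _] := tyP y1; have [_ st2 _] := tyP y2.
  rewrite t1 in st1; rewrite t2 in st2.
  rewrite /lab t1 t2; congr pair.
  by apply: codeP => //; exact: linked_trans lx0 _.
have code_lt y t : (t < r.+1)%N -> (off t + code t y < off r.+1)%N.
  move=> tr; apply: leq_trans (off_mono _ _ tr).
  by rewrite offS ltn_add2l; have [] := codeP t.
exists (fun y => off (ty y) + code (ty y) y)%N; split=> [y|y1 y2 l1 l2 e12].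
  by apply: code_lt; case: (tyP y).
have t12 : ty y1 = ty y2.
  have lt_off u v t t' : (t < t')%N ->
      (off t + code t u = off t' + code t' v)%N -> False.
    move=> tt' e; have : (off t + code t u < off t.+1)%N.
      by rewrite offS ltn_add2l; have [] := codeP t.
    by rewrite e ltnNge (leq_trans (off_mono _ _ tt')) // leq_addr.
  case: (ltngtP (ty y1) (ty y2)) => // h.
    by case: (lt_off _ _ _ _ h e12).
  by case: (lt_off _ _ _ _ h (esym e12)).
have [_ /(_ y1 y2 l1 l2 t12 erefl)] := codeP (ty y2); apply.
by move: e12; rewrite t12 => /addnI.
Qed.

End Dynamics.

(** * Rank and relations between generators *)

Lemma mul_denq_int (D : nat) (q : rat) : (`|denq q| %| D)%N ->
  exists z : int, D%:R * q = z%:~R.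
Proof.
move=> /dvdnP[c ->]; exists (c%:Z * numq q).
rewrite natrM intrM (numqE q) -pmulrn -mulrA (mulrC q).
have -> : (`|denq q|%N)%:R = (denq q)%:~R :> rat.
  by rewrite -[in RHS](absz_denq q).
by [].
Qed.

Lemma dvdn_mul_both (d e n : nat) : (d * e %| n -> (d %| n) /\ (e %| n))%N.
Proof.
by move=> den; split; apply: dvdn_trans den; [exact: dvdn_mulr|exact: dvdn_mull].
Qed.

Lemma clear_denominators n (v : 'rV[rat]_n) :
  exists d (h : 'rV[int]_n), (0 < d)%N /\ intq h = d%:R *: v.
Proof.
pose d := (\prod_i `|denq (v 0%R i)|)%N.
have dP i : exists z : int, d%:R * v 0 i = z%:~R.
  by apply: mul_denq_int; rewrite /d (bigD1 i) //= dvdn_mulr.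
have /choice[h hP] := dP; exists d, (\row_i h i); split.
  by rewrite /d prodn_gt0 // => i; rewrite absz_gt0 denq_eq0.
by apply/rowP => i; rewrite !mxE hP.
Qed.

Section RationalTensor.
Variable A : zmodType.

Definition clear_tens (D : nat) (s : seq (A * rat)) : A :=
  \sum_(p <- s) p.1 *~ Num.floor (D%:R * p.2).

(** Multiplying the coefficients by a common denominator D turns a tensor into
    an element of A; equal tensors have equal images, for every D that is
    divisible enough to make all the coefficients of a derivation integral. *)
Lemma tens_eq_clear (s t : seq (A * rat)) : tens_eq s t ->
  exists2 D, (0 < D)%N & forall D', (D %| D')%N -> clear_tens D' s = clear_tens D' t.
Proof.
elim=> {s t} [s|s t _ [D D0 h]|s t u _ [D D0 h] _ [E E0 h']
  |s s' t t' _ [D D0 h] _ [E E0 h']|s t|a a' q|a q q'|q].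
- by exists 1%N.
- by exists D => // D' /h.
- exists (D * E)%N; rewrite ?muln_gt0 ?D0 // => D' /dvdn_mul_both[DD' ED'].
  by rewrite h // h'.
- exists (D * E)%N; rewrite ?muln_gt0 ?D0 // => D' /dvdn_mul_both[DD' ED'].
  rewrite /clear_tens !big_cat /=; congr (_ + _).
    exact: h.
  exact: h'.
- by exists 1%N => // D' _; rewrite /clear_tens !big_cat /= addrC.
- by exists 1%N => // D' _; rewrite /clear_tens !big_cons !big_nil !addr0 mulrzDl.
- exists (`|denq q| * `|denq q'|)%N; first by rewrite muln_gt0 !absz_gt0 !denq_eq0.
  move=> D' /dvdn_mul_both[dq dq'].
  rewrite /clear_tens !big_cons !big_nil !addr0 /= -mulrzDr; congr (_ *~ _).
  have [z zE] := mul_denq_int dq; have [z' z'E] := mul_denq_int dq'.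
  by rewrite mulrDr zE z'E -intrD !intrKfloor.
- by exists 1%N => // D' _; rewrite /clear_tens big_cons !big_nil mul0rz addr0.
Qed.

End RationalTensor.

Section Relations.
Variable M : nmodType.

Definition gp_of (m : M) : groupification M := \pi_(groupification M)%qT (m, 0).

Lemma gp_ofD m n : gp_of (m + n) = gp_of m + gp_of n.
Proof. by rewrite /gp_of [RHS]gp_add_pi /= addr0. Qed.

Lemma gp_of0 : gp_of 0 = 0.
Proof. by []. Qed.

Lemma gp_ofMn m n : gp_of (m *+ n) = gp_of m *+ n.
Proof. by elim: n => [|n IHn]; rewrite ?gp_of0 // !mulrS gp_ofD IHn. Qed.

Lemma gp_of_eq m n : gp_of m = gp_of n -> exists c, m + c = n + c.
Proof. by move=> /gp_piP[c]; rewrite /= !addr0; exists c. Qed.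

Variables (k : nat) (g : 'I_k -> M).

Definition ev (m : 'rV[nat]_k) : M := \sum_i g i *+ m @_ i.

Lemma evD m n : ev (m + n) = ev m + ev n.
Proof. by rewrite -big_split; apply: eq_bigr => i _; rewrite addvE mulrnDr. Qed.

Lemma gp_of_ev m : gp_of (ev m) = \sum_i gp_of (g i) *+ m @_ i.
Proof.
rewrite /ev (big_morph gp_of gp_ofD gp_of0).
by apply: eq_bigr => i _; rewrite gp_ofMn.
Qed.

Hypothesis g_gen : forall m : M, exists n, m = ev n.

Local Notation tens := (scalar_ext (groupification M) rat).

Definition gen_tens i : tens := \pi_(tens)%qT [:: (gp_of (g i), 1)].

Lemma sum_gen_tens (h : 'I_k -> rat) :
  \sum_i h i *: gen_tens i =
  \pi_(tens)%qT [seq (gp_of (g i), h i) | i <- enum 'I_k].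
Proof.
rewrite -big_enum /=; elim: (enum _) => [|i s IHs]; first by rewrite big_nil.
rewrite big_cons IHs [_ *: _]tens_scale_pi [LHS]tens_add_pi.
by rewrite /tens_scaleseq /= mulr1.
Qed.

(** An integer vector whose combination of the generators vanishes over the
    rationals becomes, after multiplication by some D, an honest relation
    between two sums of generators. *)
Lemma integral_relation (h : 'rV[int]_k) :
  \sum_i (h 0 i)%:~R *: gen_tens i = 0 ->
  exists D m n, [/\ (0 < D)%N, ev m = ev n & vz m - vz n = h *+ D].
Proof.
rewrite sum_gen_tens => /tens_piP/tens_eq_clear[D D0 /(_ D (dvdnn D))].
rewrite /clear_tens big_nil big_map big_enum /= => h0.
pose p : 'rV[nat]_k := \row_i (if (0 <= h @_ i)%R then D * `|h @_ i| else 0)%N.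
pose q : 'rV[nat]_k := \row_i (if (0 <= h @_ i)%R then 0 else D * `|h @_ i|)%N.
have pq i : (p @_ i)%:Z - (q @_ i)%:Z = D%:Z * h @_ i.
  by rewrite /p /q !mxE; case: ifP; nia.
have [|c /esym pqc] := @gp_of_eq (ev p) (ev q).
  apply/eqP; rewrite -subr_eq0 !gp_of_ev -sumrB -[X in _ == X]h0; apply/eqP.
  apply: eq_bigr => i _; rewrite !pmulrn -mulrzBr pq; congr (_ *~ _).
  by rewrite -intrM intrKfloor.
have [c' cE] := g_gen c.
exists D, (p + c'), (q + c'); split=> //; first by rewrite !evD -cE.
apply/rowP => i; rewrite vzBE !addvE !PoszD mulmxnE -mulr_natl natz -pq; lia.
Qed.

(** Relations between the generators hold at every point, and the rank bounds
    from below how many independent ones there are. *)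
Lemma rank_relspan (X : eqType) (act : 'rV[nat]_k -> X -> X) r :
  has_rank M r ->
  (forall m n x, ev m = ev n -> act m x = act n x) ->
  exists a, forall x, (k <= r + \rank (relspan act a x))%N.
Proof.
move=> [e basis] act_ev.
have /choice[c cE] i : exists c : {ffun 'I_r -> rat}, gen_tens i = \sum_j c j *: e j.
  by have [c [cE _]] := basis (gen_tens i); exists c.
pose G : 'M[rat]_(k, r) := \matrix_(i, j) c i j.
have kerG (v : 'rV[rat]_k) : v *m G = 0 -> \sum_i v 0 i *: gen_tens i = 0.
  move=> vG; under eq_bigr do rewrite cE scaler_sumr.
  rewrite exchange_big /= big1 // => j _.
  under eq_bigr do rewrite scalerA; rewrite -scaler_suml.
  transitivity ((v *m G) 0 j *: e j); last by rewrite vG mxE scale0r.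
  by rewrite mxE; congr (_ *: _); apply: eq_bigr => i _; rewrite mxE.
have [a aP] : exists a, forall i, exists m n d,
    [/\ vle m a, vle n a, ev m = ev n, (0 < d)%N &
        intq (vz m - vz n) = d%:R *: row i (kermx G)].
  apply: fin_bound => [i a b ab [m [n [d [ma na e_mn d0 dE]]]]|i].
    by exists m, n, d; split=> //; [exact: vleW ab ma|exact: vleW ab na].
  have [d [h [d0 hE]]] := clear_denominators (row i (kermx G)).
  have [|D [m [n [D0 e_mn hD]]]] := integral_relation (h := h).
    rewrite -[RHS](kerG (intq h)); last first.
      by rewrite hE -scalemxAl -row_mul mulmx_ker row0 scaler0.
    by apply: eq_bigr => j _; rewrite mxE.
  exists (\max_j m @_ j + \max_j n @_ j)%N, m, n, (D * d)%N; split=> //.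
  - by move=> j; rewrite (leq_trans (leq_bigmax j)) ?leq_addr.
  - by move=> j; rewrite (leq_trans (leq_bigmax j)) ?leq_addl.
  - by rewrite muln_gt0 D0.
  - by rewrite hD raddfMn /= hE -scaler_nat scalerA natrM.
exists a => x.
have sub : (kermx G <= relspan act a x)%MS.
  apply/row_subP => i; have [m [n [d [ma na e_mn d0 dE]]]] := aP i.
  rewrite -[row i _]scale1r -(@mulVf _ (d%:R : rat)) ?pnatr_eq0 -?lt0n //.
  rewrite -scalerA -dE; apply: scalemx_sub; apply: sub_relspan => //.
  exact: act_ev.
have := mxrankS sub; rewrite mxrank_ker; have := rank_leq_col G; lia.
Qed.

End Relations.

(** * The Schreier metric *)

Section PathMetric.
Local Open Scope classical_set_scope.
Variables (X : Type) (adj : X -> X -> Prop).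
Hypothesis adj_sym : forall x y, adj x y -> adj y x.

Lemma dist_le_walk x y n :
  dist_le (path_dist adj) x y n <-> exists2 l, (l <= n)%N & walk adj x y l.
Proof.
rewrite /dist_le /path_dist; case: pselect => [h|h]; last first.
  by split=> // -[l _ w]; apply: h; exists l.
case: ex_minnP => l /asboolP wl lmin.
split=> [ln|[l' l'n w]]; first by exists l.
by apply: leq_trans l'n; apply: lmin; apply/asboolP.
Qed.

Lemma dist_le_refl x n : dist_le (path_dist adj) x x n.
Proof. by apply/dist_le_walk; exists 0%N => //; exists [::]. Qed.

Lemma dist_leW x y m n : (m <= n)%N ->
  dist_le (path_dist adj) x y m -> dist_le (path_dist adj) x y n.
Proof.
move=> mn /dist_le_walk[l lm w]; apply/dist_le_walk; exists l => //.
exact: leq_trans mn.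
Qed.

Lemma dist_le_trans x y z m n : dist_le (path_dist adj) x y m ->
  dist_le (path_dist adj) y z n -> dist_le (path_dist adj) x z (m + n).
Proof.
move=> /dist_le_walk[l lm [p [p1 p2 p3]]] /dist_le_walk[l' ln [q [q1 q2 q3]]].
apply/dist_le_walk; exists (l + l')%N; first exact: leq_add.
exists (p ++ q); split; last by rewrite size_cat p3 q3.
  by rewrite cat_path p1 p2.
by rewrite last_cat p2.
Qed.

Lemma dist_le_adj x y : adj x y -> dist_le (path_dist adj) x y 1.
Proof.
move=> xy; apply/dist_le_walk; exists 1%N => //; exists [:: y]; split=> //=.
by rewrite andbT; apply/asboolP.
Qed.

Lemma dist_le_sym x y n :
  dist_le (path_dist adj) x y n -> dist_le (path_dist adj) y x n.
Proof.
move=> /dist_le_walk[l ln [p [px pl ps]]]; apply: (dist_leW ln); rewrite -ps -pl.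
elim: p x px {y l ln pl ps} => [|z p IHp] x /=; first by move=> _; exact: dist_le_refl.
move=> /andP[/asboolP xz /IHp h]; rewrite -addn1; apply: dist_le_trans h _.
by apply: dist_le_adj; exact: adj_sym.
Qed.

End PathMetric.

Section SchreierMetric.
Local Open Scope classical_set_scope.
Variables (M : nmodType) (X : Type) (act : M -> X -> X).
Hypothesis act0 : forall x, act 0 x = x.
Hypothesis actD : forall m n x, act (m + n) x = act m (act n x).
Variables (k : nat) (g : 'I_k -> M) (S : set M).
Hypothesis S_g : forall m, S m <-> exists i, m = g i.

Let d := schreier_dist act S.
Let vact (m : 'rV[nat]_k) (x : X) := act (ev g m) x.

Lemma schreier_adj_sym x y : schreier_adj act S x y -> schreier_adj act S y x.
Proof.
case=> xy [m Sm h]; split=> [/esym //|].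
by exists m => //; case: h; [right|left].
Qed.

Lemma vactD m n x : vact (m + n) x = vact m (vact n x).
Proof. by rewrite /vact evD actD. Qed.

Lemma dist_vact m x D : vle m D -> dist_le d x (vact m x) (k * D).
Proof.
move=> mD; pose near (a : M) n := forall x, dist_le d x (act a x) n.
suff h : near (ev g m) (\sum_i m @_ i)%N.
  apply: (dist_leW _ (h x)); rewrite -[X in (X * _)%N]card_ord -sum_nat_const.
  exact: leq_sum.
have near0 : near 0 0%N by move=> y; rewrite act0; exact: dist_le_refl.
have nearD a b n n' : near a n -> near b n' -> near (a + b) (n + n')%N.
  by move=> ha hb y; rewrite addnC actD; apply: dist_le_trans (hb y) (ha _).
have nearMn i c : near (g i *+ c) c.
  elim: c => [|c IHc]; first by rewrite mulr0n.
  rewrite mulrS -[c.+1]add1n; apply: nearD => // y.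
  have [<-|ny] := pselect (y = act (g i) y); first exact: dist_le_refl.
  apply: dist_le_adj; split=> //; exists (g i); last by left.
  by apply/S_g; exists i.
by apply: (big_ind2 near) => // a n b n'; exact: nearD.
Qed.

(** Along a walk of length s the exponents on either side accumulate, since the
    monoid is commutative: points at distance s have a common image. *)
Lemma dist_linked s x y : dist_le d x y s -> @linked k {classic X} vact s x y.
Proof.
move=> /dist_le_walk[l ls [p [px pl ps]]].
suff [u [w [up wp e]]] : @linked k {classic X} vact (size p) x y.
  by exists u, w; split=> //; [apply: vleW up|apply: vleW wp]; rewrite ps.
rewrite -{}pl; elim: p x px {l ls ps} => [|z p IHp] x /=.
  by move=> _; exists 0, 0; split=> // i; rewrite mxE.
move=> /andP[/asboolP[_ [m /S_g[i ->] h]] /IHp[u [w [us ws e]]]].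
pose del : 'rV[nat]_k := \row_j (j == i : nat).
have del1 : vle del 1 by move=> j; rewrite mxE; case: eqP.
have delE : ev g del = g i.
  rewrite /ev (bigD1 i) //= mxE eqxx mulr1n big1 ?addr0 // => j /negbTE ji.
  by rewrite mxE ji mulr0n.
have delA t : vact del t = act (g i) t by rewrite /vact delE.
rewrite -addn1; case: h => [zE|xE].
  exists (u + del), w; split; [exact: vleD|exact: vleW (leq_addr _ _) ws|].
  by rewrite vactD delA -zE.
exists u, (w + del); split; [|exact: vleD|].
  exact: vleW (leq_addr _ _) us.
by rewrite xE -delA -vactD (addrC u) (addrC w) !vactD e.
Qed.

End SchreierMetric.

(** * Asymptotic dimension of the action *)

Lemma card_le_seq (X : choiceType) (A : set X) n : (A #<= `I_n)%card ->
  exists2 l : seq X, (size l <= n)%N & forall x, A x -> x \in l.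
Proof.
move=> An; have /finite_fsetP[F FE] := card_le_finite An (finite_II n).
exists (finmap.enum_fset F); last by move=> x; rewrite FE.
rewrite -card_le_II; apply: card_le_trans An; rewrite FE.
by have /card_eq_fsetP/card_eqPle[] := erefl #|` F|%fset.
Qed.

(** The fibres of a labelling form the partition: its parts are bounded because
    a label determines a nearby point, and a ball sees few labels. *)
Lemma asdim_le_labelling (X L : Type) (d : edist X) n :
  (forall s, exists (lab : X -> L) D,
    (forall x y, lab x = lab y -> dist_le d x y D) /\
    forall x, exists code : X -> nat, (forall y, code y < n.+1)%N /\
      forall y1 y2, dist_le d x y1 s -> dist_le d x y2 s -> code y1 = code y2 ->
        lab y1 = lab y2) ->
  asdim_le d n.
Proof.
move=> lab_ex s _; have [lab [D [labD code_ex]]] := lab_ex s.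
pose fib x : set X := [set y | lab y = lab x]%classic.
exists (range fib); split.
- split; first by apply/seteqP; split=> // x _; exists (fib x) => //; exists x.
    move=> _ _ [x _ <-] [y _ <-] [z []]; rewrite /fib /= => zx zy.
    by apply/seteqP; split=> t /= ->; rewrite -zx -zy.
  by move=> _ [x _ <-]; exists x.
- by exists D => _ [x _ <-] y z /= yx zx; apply: labD; rewrite yx.
move=> x; have [code [code_lt codeP]] := code_ex x.
have /choice[h hP] c : exists A : set X, forall y, dist_le d x y s -> code y = c ->
    A = fib y.
  have [[y [xy yc]]|none] := pselect (exists y, dist_le d x y s /\ code y = c).
    exists (fib y) => z xz zc; rewrite /fib (codeP y z) //.
    by rewrite yc.
  by exists (fib x) => y xy yc; case: none; exists y.
apply: (card_le_trans _ (card_image_le h _)); apply: subset_card_le.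
move=> A [[z _ <-] [y [/= yz xy]]]; exists (code y); first exact: code_lt.
by rewrite (hP _ y) // /fib yz.
Qed.

Lemma generates_ev (M : nmodType) (k : nat) (g : 'I_k -> M) (S : set M) :
  (forall m, S m -> exists i, m = g i) -> generates S ->
  forall m, exists n, m = ev g n.
Proof.
move=> Sg Sgen m.
have : smallest (@submonoid M) S m by rewrite Sgen.
move=> /(_ [set m | exists n, m = ev g n]%classic); apply; split=> [|a /Sg[i ->]].
  split=> [|a b [n ->] [n' ->]]; last by exists (n + n'); rewrite evD.
  by exists 0; rewrite /ev big1 // => i _; rewrite mxE mulr0n.
exists (\row_j (j == i : nat)); rewrite /ev (bigD1 i) //= mxE eqxx mulr1n.
by rewrite big1 ?addr0 // => j /negbTE ji; rewrite mxE ji mulr0n.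
Qed.

Lemma sum_pow3_rev r : (\sum_(t < r.+1) 3 ^ (r - t) = (N_ r).+1)%N.
Proof.
rewrite (reindex_inj rev_ord_inj) /=.
transitivity (\sum_(t < r.+1) 3 ^ t)%N.
  by apply: eq_bigr => t _; rewrite subSS subKn // -ltnS ltn_ord.
by rewrite -(big_mkord xpredT (fun t => 3 ^ t)%N) big_ltn // expn0 add1n.
Qed.

Lemma N_closed r : (N_ r)%:R = (3 ^+ r.+1 - 3) / 2 :> rat.
Proof.
have h : (2 * N_ r + 3 = 3 ^ r.+1)%N.
  elim: r => [|r IHr]; first by rewrite /N_ big_geq.
  by rewrite /N_ big_nat_recr //= -/(N_ r) mulnDr addnAC IHr [in RHS]expnS; lia.
have : (2 * N_ r + 3)%:R = (3 ^ r.+1)%:R :> rat by rewrite h.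
rewrite natrD natrM natrX => <-; lra.
Qed.

Theorem theorem1p1 (M : nmodType) (r : nat) (X : Type) (act : M -> X -> X)
    (hfg : finitely_generated M) (hrank : has_rank M r)
    (hact : monoid_action act) (hbto : bounded_to_one act) :
  asdim_action_le act (N_ r) /\
  (N_ r)%:R = (3 ^+ r.+1 - 3) / 2 :> rat.
Proof.
split; last exact: N_closed.
move=> S /finite_seqP[gs SE] Sgen; have [act0 actD] := hact.
pose k := size gs; pose g (i : 'I_k) := tnth (in_tuple gs) i.
have S_g m : S m <-> exists i, m = g i.
  rewrite SE /=; split=> [/(tnthP (in_tuple gs))[i ->]|[i ->]]; first by exists i.
  exact: mem_tnth.
have g_gen := generates_ev (fun m => (S_g m).1) Sgen.
pose vact (m : 'rV[nat]_k) (x : {classic X}) : {classic X} := act (ev g m) x.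
have vactD' m n x : vact (m + n) x = vact m (vact n x) by exact: vactD.
have bto m : exists c : nat, forall y, exists2 l : seq {classic X},
    (size l <= c)%N & forall x, vact m x = y -> x \in l.
  have [c cP] := hbto (ev g m); exists c => y.
  by have [l ls lP] := card_le_seq (X := {classic X}) (cP y); exists l => // x /lP.
have [a0 a0P] : exists a, forall x, (k <= r + \rank (relspan vact a x))%N.
  by apply: (rank_relspan g_gen hrank) => m n x e; rewrite /vact e.
apply: (@asdim_le_labelling _ (nat * X)) => s.
have [lab [D [labD labP]]] := bounded_labelling vactD' bto s a0P.
exists lab, (k * D + k * D)%N; split=> [x y lxy|x].
  have [m mD mE] := labD x; have [n nD nE] := labD y.
  have hx := dist_vact act0 actD S_g x mD; have hy := dist_vact act0 actD S_g y nD.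
  apply: dist_le_trans hx _; apply: dist_le_sym; first exact: schreier_adj_sym.
  by move: mE nE; rewrite lxy /vact => <- ->.
have [code [code_lt codeP]] := labP x; exists code; split=> [y|y1 y2 h1 h2].
  by rewrite -sum_pow3_rev.
by apply: codeP; apply: (dist_linked actD S_g).
Qed.
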